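(* Let $\mathbb{F}$ be a field and let $q\in\mathbb{F}^*$ be not a root of unity. Let $m,n$ be positive integers with $\gcd(m,n)=1$, and let $f:\mathbb{Z}\to\mathbb{F}^*$ satisfy $f(i+n)=qf(i)$ for all $i\in\mathbb{Z}$. View $\mathsf{V}^{m,n}_f=\mathbb{F}[t^{\pm1}]$ as a representation of the $q$-Weyl algebra $\mathbb{A}_1(q)$ via $$X.t^i=t^{i+n},\qquad Y.t^i=\frac{1}{q-1}\left(f(i)t^{i-m-n}-t^{i-n}\right)\quad\text{for all } i\in\mathbb{Z}.$$ Then: (a) $\mathsf{V}^{m,n}_f$ is an irreducible representation of $\mathbb{A}_1(q)$. (b) For positive integers $m',n'$ and $f':\mathbb{Z}\to\mathbb{F}^*$ satisfying $f'(i+n')=qf'(i)$ for all $i\in\mathbb{Z}$, we have $\mathsf{V}^{m,n}_f\simeq\mathsf{V}^{m',n'}_{f'}$ as representations of $\mathbb{A}_1(q)$ if and only if $m=m'$, $n=n'$ and $\mathsf{s}_{f'}(0)=q^k\mathsf{s}_f(0)$ for some $k\in\mathbb{Z}$, where $\mathsf{s}_f(0)=\prod_{i=0}^{n-1}f(-im)$ and $\mathsf{s}_{f'}(0)=\prod_{i=0}^{n'-1}f'(-im')$. (c) $\mathsf{V}^{m,n}_f$ is not semisimple as a representation over the polynomial subalgebra of $\mathbb{A}_1(q)$ generated by $XY$; hence $\mathsf{V}^{m,n}_f$ is not a weight representation of $\mathbb{A}_1(q)$.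
   Context: $\mathbb{F}$ is a field of arbitrary characteristic, not necessarily algebraically closed, with group of units $\mathbb{F}^*$. The $q$-Weyl algebra is the unital associative algebra $\mathbb{A}_1(q)=\mathbb{F}\{X,Y\}/(YX-qXY-1)$ with generators $X,Y$ and relation $YX-qXY=1$. Representations are left modules. For any positive integers $m,n$ and $f:\mathbb{Z}\to\mathbb{F}^*$ with $f(i+n)=qf(i)$ for all $i\in\mathbb{Z}$, the representation $\mathsf{V}^{m,n}_f$ of $\mathbb{A}_1(q)$ has underlying space the Laurent polynomials $\mathbb{F}[t^{\pm1}]$ and action $X.t^i=t^{i+n}$, $Y.t^i=\frac{1}{q-1}(f(i)t^{i-m-n}-t^{i-n})$ for all $i\in\mathbb{Z}$. A representation of $\mathbb{A}_1(q)$ is a weight representation if it is semisimple as a representation of the polynomial subalgebra generated by $XY$. *)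

(* Defs.v *)
From HB Require Import structures.
From mathcomp Require Import all_boot all_order all_algebra.
From mathcomp Require Import boolp.
From mathcomp Require Import finmap monalg.

Set Implicit Arguments.
Unset Strict Implicit.
Unset Printing Implicit Defensive.

Import GRing.Theory.
Local Open Scope quotient_scope.
Local Open Scope ring_scope.

Section LinearExtension.
Variables (K : choiceType) (R : nzRingType) (V : lmodType R) (e : K -> V).

(* The linear map defined on the basis [<< k >>] of [{malg R[K]}] by [e]. *)
Definition linext (g : {malg R[K]}) : V := \sum_(k <- msupp g) g@_k *: e k.

Lemma linextEw (D : {fset K}) (g : {malg R[K]}) :
  (msupp g `<=` D)%fset -> linext g = \sum_(k <- D) g@_k *: e k.
Proof.
move=> sgD; apply: big_fset_incl => // k _ /mcoeff_outdom ->.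
exact: scale0r.
Qed.

Fact linext_is_linear : linear linext.
Proof.
move=> c g h; pose D := (msupp g `|` msupp h)%fset.
have sD : (msupp (c *: g + h)%R `<=` D)%fset.
  apply: fsubset_trans (msuppD_le _ _) _.
  by apply: fsetUSS (fsubset_refl _); apply: msuppZ_le.
rewrite (linextEw sD) (linextEw (fsubsetUl _ _ : _ `<=` D)%fset).
rewrite (linextEw (fsubsetUr _ _ : _ `<=` D)%fset).
rewrite scaler_sumr -big_split /=; apply: eq_bigr => k _.
by rewrite mcoeffD mcoeffZ scalerDl scalerA.
Qed.
HB.instance Definition _ :=
  GRing.isLinear.Build R {malg R[K]} V _ linext linext_is_linear.

Lemma linextU k : linext << k >> = e k.
Proof. by rewrite /linext msuppU oner_eq0 big_seq_fset1 mcoeffUU scale1r. Qed.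

End LinearExtension.

Lemma linext_ext (K : choiceType) (R : nzRingType) (V : lmodType R)
    (phi psi : {linear {malg R[K]} -> V}) :
  (forall k, phi << k >> = psi << k >>) -> phi =1 psi.
Proof.
move=> eq_b g; rewrite (monalgE g) !linear_sum; apply: eq_bigr => k _.
have -> : << g@_k *g k >> = g@_k *: << k >> :> {malg R[K]}.
  by apply/malgP => l; rewrite mcoeffZ !mcoeffU mulrnAr mulr1.
by rewrite !linearZ eq_b.
Qed.

Notation freeAlg F := {malg F[{fmonom 'I_2}]}.

Definition freeX (F : fieldType) : freeAlg F := << fmu ord0 >>.
Definition freeY (F : fieldType) : freeAlg F := << fmu ord_max >>.

Definition qweyl_relator (F : fieldType) (q : F) : freeAlg F :=
  freeY F * freeX F - q *: (freeX F * freeY F) - 1.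

Section FreeAction.
Variables (F : fieldType) (V : lmodType F) (x y : {linear V -> V}).

Definition letter_act (i : 'I_2) : V -> V := if i == ord0 then x else y.

Definition word_act (w : {fmonom 'I_2}) (v : V) : V :=
  foldr letter_act v w.

(* The action of noncommutative polynomials for which the letters [X] and [Y]
   act as the operators [x] and [y]. *)
Definition free_act (p : freeAlg F) (v : V) : V := linext (word_act^~ v) p.

Lemma free_actU w v : free_act << w >> v = word_act w v.
Proof. exact: linextU. Qed.

Lemma free_act1 v : free_act 1 v = v.
Proof. by rewrite free_actU /word_act fm1. Qed.

Lemma free_actX v : free_act (freeX F) v = x v.
Proof. by rewrite free_actU /word_act fmU. Qed.

Lemma free_actY v : free_act (freeY F) v = y v.
Proof. by rewrite free_actU /word_act fmU. Qed.

Fact word_act_is_linear w : linear (word_act w).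
Proof.
move=> c u v; rewrite /word_act; elim: (w : seq _) => //= i s ->.
by rewrite /letter_act; case: ifP => _; rewrite linearP.
Qed.

Lemma free_act_linearr p : linear (free_act p).
Proof.
move=> c u v; rewrite /free_act /linext scaler_sumr -big_split /=.
apply: eq_bigr => w _.
by rewrite word_act_is_linear scalerDr !scalerA mulrC.
Qed.

HB.instance Definition _ p :=
  GRing.isLinear.Build F V V _ (free_act p) (free_act_linearr p).

Lemma free_actDl p p' v : free_act (p + p') v = free_act p v + free_act p' v.
Proof. exact: linearD. Qed.
Lemma free_actBl p p' v : free_act (p - p') v = free_act p v - free_act p' v.
Proof. exact: linearB. Qed.
Lemma free_actZl c p v : free_act (c *: p) v = c *: free_act p v.
Proof. exact: linearZ. Qed.
Lemma free_act_suml (J : Type) (r : seq J) (p : J -> freeAlg F) v :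
  free_act (\sum_(j <- r) p j) v = \sum_(j <- r) free_act (p j) v.
Proof. exact: linear_sum. Qed.

Lemma free_actM p p' v : free_act (p * p') v = free_act p (free_act p' v).
Proof.
have malgU (c : F) w : << c *g w >> = c *: << w >> :> freeAlg F.
  by apply/malgP => l; rewrite mcoeffZ !mcoeffU mulrnAr mulr1.
rewrite malgME free_act_suml [RHS]/free_act /linext; apply: eq_bigr => w _.
rewrite free_act_suml [free_act p' v]/free_act /linext.
have: linear (word_act w) by exact: word_act_is_linear.
set g := word_act w => g_lin.
have -> : g (\sum_(k <- msupp p') p'@_k *: word_act k v)
          = \sum_(k <- msupp p') p'@_k *: g (word_act k v).
  pose G : {linear V -> V} :=
    HB.pack g (GRing.isLinear.Build F V V _ g g_lin).
  rewrite -[g]/(G : V -> V) linear_sum; apply: eq_bigr => k _.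
  by rewrite linearZ.
rewrite scaler_sumr; apply: eq_bigr => k _.
rewrite malgU free_actZl free_actU scalerA; congr (_ *: _).
by rewrite /g /word_act fmM foldr_cat.
Qed.

End FreeAction.

Section QWeylAlgebra.
Variables (F : fieldType) (q : F).

Definition qweyl_ideal : {pred freeAlg F} := fun p =>
  `[< exists s : seq (freeAlg F * freeAlg F),
        p = \sum_(ab <- s) ab.1 * qweyl_relator q * ab.2 >].

Fact qweyl_ideal_zmod : zmod_closed qweyl_ideal.
Proof.
split=> [|p p' /asboolP[s ->] /asboolP[s' ->]]; apply/asboolP.
  by exists [::]; rewrite big_nil.
exists (s ++ [seq (- ab.1, ab.2) | ab <- s']).
rewrite big_cat big_map /= -sumrN; congr (_ + _).
by apply: eq_bigr => ab _; rewrite (mulNr ab.1) (mulNr (ab.1 * _)).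
Qed.
HB.instance Definition _ :=
  GRing.isZmodClosed.Build (freeAlg F) qweyl_ideal qweyl_ideal_zmod.

Lemma qweyl_idealMl a p : p \in qweyl_ideal -> a * p \in qweyl_ideal.
Proof.
move=> /asboolP[s ->]; apply/asboolP.
exists [seq (a * ab.1, ab.2) | ab <- s]; rewrite big_map mulr_sumr.
by apply: eq_bigr => ab _; rewrite !mulrA.
Qed.

Lemma qweyl_idealMr b p : p \in qweyl_ideal -> p * b \in qweyl_ideal.
Proof.
move=> /asboolP[s ->]; apply/asboolP.
exists [seq (ab.1, ab.2 * b) | ab <- s]; rewrite big_map mulr_suml.
by apply: eq_bigr => ab _; rewrite !mulrA.
Qed.

Lemma qweyl_relator_ideal : qweyl_relator q \in qweyl_ideal.
Proof. by apply/asboolP; exists [:: (1, 1)]; rewrite big_seq1 mul1r mulr1. Qed.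

Lemma free_act_ideal (V : lmodType F) (x y : {linear V -> V}) p v :
  (forall u, y (x u) - q *: x (y u) = u) ->
  p \in qweyl_ideal -> free_act x y p v = 0.
Proof.
move=> xy /asboolP[s ->]; rewrite free_act_suml big1 // => ab _.
rewrite !free_actM; set u := free_act _ _ ab.2 v.
rewrite (_ : free_act _ _ (qweyl_relator q) u = 0) ?linear0 //.
have: free_act x y (freeY F * freeX F) u = y (x u).
  exact: (etrans (free_actM _ _ _ _ _)
           (etrans (free_actY _ _ _) (congr1 y (free_actX _ _ _)))).
have: free_act x y (freeX F * freeY F) u = x (y u).
  exact: (etrans (free_actM _ _ _ _ _)
           (etrans (free_actX _ _ _) (congr1 x (free_actY _ _ _)))).
rewrite /qweyl_relator.
move: (freeX F * freeY F) (freeY F * freeX F) => a b aE bE.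
by rewrite free_actBl free_act1 free_actBl free_actZl aE bE xy subrr.
Qed.

(* The representation [X.z^i = z^(i+1)], [Y.z^i = (1 + ... + q^(i-1)) z^(i-1)]
   shows that the quotient is nonzero. *)
Fact qweyl_ideal1 : 1 \notin qweyl_ideal.
Proof.
pose V : lmodType F := {malg F[nat]}.
pose c i := \sum_(j < i) q ^+ j; pose t (i : nat) : V := << i >>.
pose x : {linear V -> V} := linext (fun i => t i.+1).
pose y : {linear V -> V} := linext (fun i => c i *: t i.-1).
have xE i : x (t i) = t i.+1 by exact: linextU.
have yE i : y (t i) = c i *: t i.-1 by exact: linextU.
have cS i : c i.+1 = 1 + q * c i.
  rewrite /c big_ord_recl mulr_sumr; congr (_ + _).
  by apply: eq_bigr => j _; rewrite -exprS.
have xy u : y (x u) - q *: x (y u) = u.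
  pose z : {linear V -> V} := (y \o x) \- (q \*: (x \o y)).
  apply: (linext_ext (phi := z) (psi := idfun)) => i.
  rewrite -[LHS]/(y (x (t i)) - q *: x (y (t i))) -[RHS]/(t i).
  have xZ a v : x (a *: v) = a *: x v by exact: linearZ.
  rewrite xE !yE xZ xE scalerA.
  case: i => [|i] /=.
    by rewrite cS /c big_ord0 mulr0 addr0 scale0r subr0 scale1r.
  by rewrite -scalerBl cS addrK scale1r.
apply/negP => /(free_act_ideal (t 0%N) xy).
by rewrite free_act1 => /eqP; rewrite /t monalgU_eq0 oner_eq0.
Qed.

Definition qWeyl : Type := Quotient.quot qweyl_ideal.

HB.instance Definition _ := GRing.Zmodule.on qWeyl.
HB.instance Definition _ := EqQuotient.on qWeyl.

Lemma qweyl_eqP (p p' : freeAlg F) :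
  \pi_qWeyl p = \pi_qWeyl p' <-> p - p' \in qweyl_ideal.
Proof. by rewrite Quotient.idealrBE; split => [/eqP|/eqP]. Qed.

Lemma qweyl_reprB p : repr (\pi_qWeyl p) - p \in qweyl_ideal.
Proof. by apply/qweyl_eqP; rewrite reprK. Qed.

Lemma qweyl_piD p p' : \pi_qWeyl (p + p') = \pi_qWeyl p + \pi_qWeyl p'.
Proof. exact: Quotient.pi_add. Qed.

Lemma qweyl_piN p : \pi_qWeyl (- p) = - \pi_qWeyl p.
Proof. exact: Quotient.pi_opp. Qed.

Lemma qweyl_pi0 : \pi_qWeyl 0 = 0.
Proof. by rewrite -[LHS](addrK (\pi_qWeyl 0)) -qweyl_piD addr0 subrr. Qed.

Definition qweyl_mul (a b : qWeyl) : qWeyl := \pi_qWeyl (repr a * repr b).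
Definition qweyl_scale (c : F) (a : qWeyl) : qWeyl := \pi_qWeyl (c *: repr a).

Lemma qweyl_piM p p' :
  \pi_qWeyl (p * p') = qweyl_mul (\pi_qWeyl p) (\pi_qWeyl p').
Proof.
apply/esym/qweyl_eqP.
have -> : repr (\pi_qWeyl p) * repr (\pi_qWeyl p') - p * p' =
   (repr (\pi_qWeyl p) - p) * repr (\pi_qWeyl p')
   + p * (repr (\pi_qWeyl p') - p').
  by rewrite mulrBl mulrBr addrA subrK.
apply: rpredD; first exact/qweyl_idealMr/qweyl_reprB.
exact/qweyl_idealMl/qweyl_reprB.
Qed.

Lemma qweyl_piZ c p : \pi_qWeyl (c *: p) = qweyl_scale c (\pi_qWeyl p).
Proof.
apply/esym/qweyl_eqP; rewrite -scalerBr -mul_malgC.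
exact/qweyl_idealMl/qweyl_reprB.
Qed.

Lemma qweyl_ind (P : qWeyl -> Prop) :
  (forall p, P (\pi_qWeyl p)) -> forall a, P a.
Proof. by move=> Ppi a; rewrite -[a]reprK. Qed.

Fact qweyl_mulA : associative qweyl_mul.
Proof.
elim/qweyl_ind=> a; elim/qweyl_ind=> b; elim/qweyl_ind=> c.
by rewrite -(qweyl_piM b c) -(qweyl_piM a b) -!qweyl_piM mulrA.
Qed.
Fact qweyl_mul1l : left_id (\pi_qWeyl 1) qweyl_mul.
Proof. by elim/qweyl_ind=> a; rewrite -qweyl_piM mul1r. Qed.
Fact qweyl_mul1r : right_id (\pi_qWeyl 1) qweyl_mul.
Proof. by elim/qweyl_ind=> a; rewrite -qweyl_piM mulr1. Qed.
Fact qweyl_mulDl : left_distributive qweyl_mul +%R.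
Proof.
elim/qweyl_ind=> a; elim/qweyl_ind=> b; elim/qweyl_ind=> c.
by rewrite -(qweyl_piD a b) -!qweyl_piM mulrDl qweyl_piD.
Qed.
Fact qweyl_mulDr : right_distributive qweyl_mul +%R.
Proof.
elim/qweyl_ind=> a; elim/qweyl_ind=> b; elim/qweyl_ind=> c.
by rewrite -(qweyl_piD b c) -!qweyl_piM mulrDr qweyl_piD.
Qed.
Fact qweyl_1neq0 : \pi_qWeyl 1 != 0.
Proof.
apply/eqP; rewrite -qweyl_pi0 => /qweyl_eqP; rewrite subr0.
exact/negP/qweyl_ideal1.
Qed.
HB.instance Definition _ := GRing.Zmodule_isNzRing.Build qWeyl
  qweyl_mulA qweyl_mul1l qweyl_mul1r qweyl_mulDl qweyl_mulDr qweyl_1neq0.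

Fact qweyl_scaleA c d a :
  qweyl_scale c (qweyl_scale d a) = qweyl_scale (c * d) a.
Proof.
by elim/qweyl_ind: a => a; rewrite -(qweyl_piZ d) -!qweyl_piZ scalerA.
Qed.
Fact qweyl_scale1 : left_id 1 qweyl_scale.
Proof. by elim/qweyl_ind=> a; rewrite -qweyl_piZ scale1r. Qed.
Fact qweyl_scaleDr : right_distributive qweyl_scale +%R.
Proof.
move=> c; elim/qweyl_ind=> a; elim/qweyl_ind=> b.
by rewrite -(qweyl_piD a b) -!qweyl_piZ scalerDr qweyl_piD.
Qed.
Fact qweyl_scaleDl a : {morph qweyl_scale^~ a : c d / c + d}.
Proof.
by move=> c d; elim/qweyl_ind: a => a; rewrite -!qweyl_piZ scalerDl qweyl_piD.
Qed.
HB.instance Definition _ := GRing.Zmodule_isLmodule.Build F qWeyl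
  qweyl_scaleA qweyl_scale1 qweyl_scaleDr qweyl_scaleDl.

Fact qweyl_scaleAl (c : F) (a b : qWeyl) : c *: (a * b) = (c *: a) * b.
Proof.
elim/qweyl_ind: a => a; elim/qweyl_ind: b => b.
rewrite -[_ * _ in LHS]qweyl_piM -[_ *: \pi_qWeyl a]qweyl_piZ.
by rewrite -[LHS]qweyl_piZ -[RHS]qweyl_piM scalerAl.
Qed.
HB.instance Definition _ := GRing.Lmodule_isLalgebra.Build F qWeyl
  qweyl_scaleAl.

Fact qweyl_scaleAr (c : F) (a b : qWeyl) : c *: (a * b) = a * (c *: b).
Proof.
have scaleAr (p p' : freeAlg F) : c *: (p * p') = p * (c *: p').
  apply/malgP => w; rewrite mcoeffZ [in LHS]mcoeffMl.
  rewrite (mcoeffMlw _ (fsubset_refl _) (msuppZ_le c p')) mulr_sumr.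
  apply: eq_bigr => u _; rewrite mulr_sumr; apply: eq_bigr => v _.
  by rewrite mcoeffZ mulrCA mulrnAr.
elim/qweyl_ind: a => a; elim/qweyl_ind: b => b.
rewrite -[_ * _ in LHS]qweyl_piM -[_ *: \pi_qWeyl b]qweyl_piZ.
by rewrite -[LHS]qweyl_piZ -[RHS]qweyl_piM scaleAr.
Qed.
HB.instance Definition _ := GRing.Lalgebra_isAlgebra.Build F qWeyl
  qweyl_scaleAr.

Definition qX : qWeyl := \pi_qWeyl (freeX F).
Definition qY : qWeyl := \pi_qWeyl (freeY F).

Lemma qweyl_relation : qY * qX - q *: (qX * qY) = 1.
Proof.
rewrite -[qY * qX]qweyl_piM -[qX * qY]qweyl_piM -[q *: _]qweyl_piZ.
rewrite -qweyl_piN -qweyl_piD.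
by apply/qweyl_eqP; apply: qweyl_relator_ideal.
Qed.

Section Representation.
Variables (V : lmodType F) (x y : {linear V -> V}).

(* [V] as a [qWeyl]-module, with [qX] and [qY] acting as [x] and [y]. *)
Definition qweyl_rep of (forall v, y (x v) - q *: x (y v) = v) : Type := V.

Hypothesis xy : forall v, y (x v) - q *: x (y v) = v.
Local Notation W := (qweyl_rep xy).

HB.instance Definition _ := GRing.Zmodule.on W.

Definition qweyl_act (a : qWeyl) (v : W) : W := free_act x y (repr a) v.

Lemma qweyl_act_pi p v : qweyl_act (\pi_qWeyl p) v = free_act x y p v.
Proof.
apply/eqP; rewrite -subr_eq0 -free_actBl.
by rewrite (free_act_ideal _ xy) // qweyl_reprB.
Qed.

Fact qweyl_actA a b v : qweyl_act a (qweyl_act b v) = qweyl_act (a * b) v.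
Proof.
elim/qweyl_ind: a => a; elim/qweyl_ind: b => b.
by rewrite -[_ * _ in RHS]qweyl_piM !qweyl_act_pi free_actM.
Qed.
Fact qweyl_act1 : left_id 1 qweyl_act.
Proof. by move=> v; rewrite qweyl_act_pi free_act1. Qed.
Fact qweyl_actDr : right_distributive qweyl_act +%R.
Proof. by move=> a u v; apply: linearD. Qed.
Fact qweyl_actDl v : {morph qweyl_act^~ v : a b / a + b}.
Proof.
elim/qweyl_ind=> a; elim/qweyl_ind=> b.
by rewrite -(qweyl_piD a b) !qweyl_act_pi free_actDl.
Qed.
HB.instance Definition _ := GRing.Zmodule_isLmodule.Build qWeyl W
  qweyl_actA qweyl_act1 qweyl_actDr qweyl_actDl.

Lemma qweyl_rep_X (v : W) : qX *: v = x v.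
Proof. by rewrite [LHS]qweyl_act_pi free_actX. Qed.

Lemma qweyl_rep_Y (v : W) : qY *: v = y v.
Proof. by rewrite [LHS]qweyl_act_pi free_actY. Qed.

Lemma qweyl_rep_scalar (c : F) (v : W) : c%:A *: v = c *: (v : V).
Proof.
rewrite -[c%:A]qweyl_piZ [LHS]qweyl_act_pi free_actZl free_act1 //.
Qed.

End Representation.
End QWeylAlgebra.

Arguments qX {F q}.
Arguments qY {F q}.

Section LaurentRepresentation.
Variables (F : fieldType) (q : F) (m n : nat) (f : int -> F).

(* Laurent polynomials are finitely supported functions on the exponents:
   [<< i >>] is [t^i]. *)
Local Notation laurent := {malg F[int]}.

Definition laurentX : laurent -> laurent := linext (fun i => << i + n%:Z >>).

Definition laurentY : laurent -> laurent := linext (fun i =>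
  (q - 1)^-1 *: (f i *: << i - m%:Z - n%:Z >> - << i - n%:Z >>)).

HB.instance Definition _ := GRing.Linear.on laurentX.
HB.instance Definition _ := GRing.Linear.on laurentY.

Lemma laurentXU i : laurentX << i >> = << i + n%:Z >>.
Proof. exact: linextU. Qed.

Lemma laurentYU i : laurentY << i >> =
  (q - 1)^-1 *: (f i *: << i - m%:Z - n%:Z >> - << i - n%:Z >>).
Proof. exact: linextU. Qed.

Hypothesis q1 : q != 1.
Hypothesis fq : forall i, f (i + n%:Z) = q * f i.

Lemma laurent_relation v :
  laurentY (laurentX v) - q *: laurentX (laurentY v) = v.
Proof.
pose z : {linear laurent -> laurent} :=
  (laurentY \o laurentX) \- (q \*: (laurentX \o laurentY)).
apply: (linext_ext (phi := z) (psi := idfun)) => i.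
rewrite -[LHS]/(laurentY (laurentX << i >>) - q *: laurentX (laurentY << i >>)).
set T : laurent := << i - m%:Z >>; set S : laurent := << i >>.
have -> : laurentX (laurentY S) = (q - 1)^-1 *: (f i *: T - S).
  have [lZ lB] : scalable laurentX /\ {morph laurentX : u v / u - v}.
    by split=> [c u|u w]; [apply: linearZ | apply: linearB].
  by rewrite laurentYU lZ lB lZ !laurentXU !subrK.
have -> : laurentY (laurentX S) = (q - 1)^-1 *: ((q * f i) *: T - S).
  have E : i + n%:Z - m%:Z - n%:Z = i - m%:Z by rewrite addrAC addrK.
  by rewrite laurentXU laurentYU fq addrK E.
have -> c (W : laurent) : q *: (c *: W) = c *: (q *: W).
  by rewrite !scalerA mulrC.
rewrite -scalerBr [q *: (_ - _)]scalerBr scalerA.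
have -> : (q * f i) *: T - S - ((q * f i) *: T - q *: S) = q *: S - S.
  by rewrite opprB addrC addrA subrK.
by rewrite -{2}[S]scale1r -scalerBl scalerA mulVf ?scale1r ?subr_eq0.
Qed.

Definition laurent_rep : Type := qweyl_rep laurent_relation.
HB.instance Definition _ := GRing.Lmodule.on laurent_rep.

Definition laurent_t (i : int) : laurent_rep := << i >> : laurent.

Lemma laurent_rep_X i : qX *: laurent_t i = laurent_t (i + n%:Z).
Proof. by rewrite [LHS]qweyl_rep_X /= laurentXU. Qed.

Lemma laurent_rep_Y i : qY *: laurent_t i =
  (q - 1)^-1 *: (f i *: << i - m%:Z - n%:Z >> - << i - n%:Z >>) :> laurent.
Proof. by rewrite [LHS]qweyl_rep_Y /= laurentYU. Qed.

Lemma laurent_rep_scalar (c : F) (v : laurent_rep) :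
  c%:A *: v = c *: (v : laurent) :> laurent.
Proof. exact: qweyl_rep_scalar. Qed.

End LaurentRepresentation.

Section Modules.
Variables (R : pzRingType) (V : lmodType R).

Definition is_submodule (B : R -> Prop) (W : V -> Prop) : Prop :=
  [/\ W 0, forall u v, W u -> W v -> W (u - v)
    & forall b v, B b -> W v -> W (b *: v)].

Definition irreducible_submodule (B : R -> Prop) (W : V -> Prop) : Prop :=
  [/\ is_submodule B W, exists2 v, W v & v != 0
    & forall U, is_submodule B U -> (forall v, U v -> W v) ->
        (forall v, U v -> v = 0) \/ (forall v, W v -> U v)].

(* [V], as a module over the subring [B] of [R], is the sum of its irreducible
   submodules. *)
Definition semisimple_over (B : R -> Prop) : Prop :=
  forall v : V, exists2 s : seq V, v = \sum_(w <- s) w &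
    {in s, forall w, exists2 W, irreducible_submodule B W & W w}.

Definition irreducible_module : Prop :=
  irreducible_submodule (fun=> True) (fun=> True).

End Modules.

Definition isomorphic (R : pzRingType) (V W : lmodType R) : Prop :=
  exists phi : {linear V -> W}, bijective phi.

(* [b] lies in the subalgebra generated by [a], the image of [F[x]] under the
   algebra morphism [x |-> a]. *)
Definition generated_subalgebra (F : fieldType) (A : algType F) (a b : A) :=
  exists p : {poly F}, b = horner_alg a p.

Definition weight_representation (F : fieldType) (q : F)
    (V : lmodType (qWeyl q)) : Prop :=
  semisimple_over V (generated_subalgebra (qX * qY)).

Definition not_root_of_unity (F : fieldType) (q : F) : Prop :=
  forall k : nat, (0 < k)%N -> ~~ k.-unity_root q.

Lemma not_root_of_unity_neq1 (F : fieldType) (q : F) :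
  not_root_of_unity q -> q != 1.
Proof. by move/(_ 1%N isT); rewrite unity_rootE expr1. Qed.

(* Main.v *)
From HB Require Import structures.
Require Import Defs.
From mathcomp Require Import all_boot all_order all_algebra.
From mathcomp Require Import boolp finmap monalg zify ring.

Set Implicit Arguments.
Unset Strict Implicit.
Unset Printing Implicit Defensive.

Import Order.TTheory GRing.Theory Num.Theory.
Local Open Scope ring_scope.

(** Put [H = 1 + (q - 1) X Y]. The formula for [Y] is made so that [H] acts by
    the weighted shift [H.t^i = f(i) t^(i-m)], next to the plain shift
    [X.t^i = t^(i+n)]. Hence [K = H^n X^m] is diagonal in the monomials: [t^i]
    has the eigenvalue [s_f(i + mn)], where [s_f(i)] is the product of the
    [f(i - km)], [k < n] ([orbprod] below). Since [s_f(i + n) = q^n s_f(i)]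
    and, by telescoping, [s_f(i + m) = q^m s_f(i)], coprimality of [m] and [n]
    gives [s_f(i) = q^i s_f(0)] ([orbprodD]); as [q] is not a root of unity, the
    eigenvalues of [K] are pairwise distinct.

    Irreducibility. A subspace stable under a diagonal operator with distinct
    eigenvalues contains every monomial that occurs in one of its elements
    ([diag_stable_mem]), so a nonzero submodule contains some [t^k]; the
    operators [H^b X^a] carry it, up to units, to all [t^(k + an - bm)], and
    every integer is of the form [an - bm] with natural numbers [a], [b].

    Isomorphism, necessity. The lowest exponent of a Laurent polynomial is
    moved by exactly [an - bm] under [H^b X^a]. An isomorphism to the
    representation with parameters [m'], [n'] sends [t^0] to an eigenvector of
    [K], whose lowest exponent [K] moves by [mn' - nm']; so [mn' = nm'].
    Then each [t'^i] is an eigenvector of [K], hence the image of a monomial up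
    to a unit. Comparing how one operator [H^b X^a] links the monomials over
    [t'^0] and [t'^1] gives [1 = an' - bm'], so [m'] and [n'] are coprime too and
    [m = m'], [n = n']. The eigenvalue of [K] on [t'^0] is then read on both
    sides: [q^(mn) s_f'(0) = q^(k+mn) s_f(0)].

    Isomorphism, sufficiency. One looks for [t^i |-> c(i) t'^(i-k)] with [c]
    periodic modulo [n] and [c(i-m) f(i) = f'(i-k) c(i)]. On the cycle of the
    residues modulo [n] under [i |-> i - m] this prescribes the successive
    quotients of [c], and it closes up exactly when their product over the
    cycle is [1] ([prod_periodic_cocycle]), which is the hypothesis on [s_f(0)]
    and [s_f'(0)].

    Semisimplicity. [XY] lowers lowest exponents by exactly [m], so no nonzero
    polynomial in [XY] kills a nonzero vector ([lowest_at_poly_XY]): a torsion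
    free module over a polynomial algebra in one variable has no irreducible
    submodule. *)

(** * Laurent polynomials by their coefficients *)

Lemma mcoeff_basis (K : choiceType) (R : nzRingType) (k l : K) :
  (<< k >> : {malg R[K]})@_l = (k == l)%:R.
Proof. exact: mcoeffU. Qed.

Lemma malg_neq0P (K : choiceType) (R : nzRingType) (v : {malg R[K]}) :
  v != 0 -> exists k, v@_k != 0.
Proof.
move=> v0; apply: contrapT => vN; case/eqP: v0; apply/malgP => k.
by rewrite mcoeff0; apply: contrapT => /eqP vk; apply: vN; exists k.
Qed.

Lemma mcoeff_linext (F : fieldType) (K K' : choiceType) (e : K' -> {malg F[K]})
    (v : {malg F[K']}) j :
  (linext e v)@_j = \sum_(k <- msupp v) v@_k * (e k)@_j.
Proof.
rewrite /linext raddf_sum /=; apply: eq_bigr => k _; exact: mcoeffZ.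
Qed.

Lemma mcoeff_linextU (F : fieldType) (K : choiceType) (e : K -> {malg F[K]})
    (s s' : K -> K) (c : K -> F) (v : {malg F[K]}) j :
  (forall k, e k = c k *: << s k >>) -> cancel s s' -> cancel s' s ->
  (linext e v)@_j = c (s' j) * v@_(s' j).
Proof.
move=> eE sK s'K; rewrite mcoeff_linext [in RHS](monalgE v) raddf_sum mulr_sumr /=.
apply: eq_bigr => k _; rewrite eE mcoeffZ mcoeff_basis mcoeffU (can2_eq sK s'K).
by case: eqVneq => [->|]; rewrite ?mulr0 //= !mulr1n mulr1 mulrC.
Qed.

(** If two basis elements [k] and [l] occur in [v], then [D v - lam l *: v]
    still involves [k], by distinctness of the eigenvalues, but no longer [l]:
    the support can be shrunk to [k] alone without leaving [U]. *)
Lemma diag_stable_mem (K : choiceType) (F : fieldType)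
    (D : {malg F[K]} -> {malg F[K]}) (lam : K -> F)
    (U : {malg F[K]} -> Prop) :
    (forall v k, (D v)@_k = lam k * v@_k) -> injective lam ->
    (forall u v, U u -> U v -> U (u - v)) ->
    (forall c v, U v -> U (c *: v)) -> (forall v, U v -> U (D v)) ->
  forall v k, U v -> v@_k != 0 -> U << k >>.
Proof.
move=> DE lam_inj UB UZ UD v k.
have [N] := ubnP #|` msupp v|; elim: N v => // N IHN v ltvN Uv vk.
have [[l lk vl]|one] := pselect (exists2 l, l != k & v@_l != 0).
  pose w : {malg F[K]} := D v - lam l *: v.
  have wE j : w@_j = (lam j - lam l) * v@_j.
    by rewrite mcoeffB DE mcoeffZ mulrBl.
  apply: (IHN w); last 2 first.
  - by apply: UB; [apply: UD | apply: UZ].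
  - by rewrite wE mulf_neq0 // subr_eq0 inj_eq // eq_sym.
  rewrite ltnS in ltvN; apply: leq_trans ltvN; apply: fproper_ltn_card.
  rewrite fproperE; apply/andP; split; last first.
    apply/negP=> /fsubsetP/(_ l); rewrite -!mcoeff_neq0 wE subrr mul0r eqxx.
    by move=> /(_ vl).
  apply/fsubsetP => j; rewrite -!mcoeff_neq0 wE.
  by apply: contra_neq => ->; rewrite mulr0.
suff -> : << k >> = (v@_k)^-1 *: v by apply: UZ.
apply/malgP => j; rewrite mcoeff_basis mcoeffZ; case: eqVneq => [<-|kj].
  by rewrite mulVf.
case: (eqVneq v@_j 0) => [->|vj]; first by rewrite mulr0.
by case: one; exists j => //; rewrite eq_sym.
Qed.

(** * Lowest exponents *)

(** [v] is nonzero and its valuation at [t = 0] is [i]; a relation rather than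
    a function, so that [0] needs no convention. *)
Definition lowest_at (F : fieldType) (i : int) (v : {malg F[int]}) :=
  v@_i != 0 /\ forall j, j < i -> v@_j = 0.

Lemma lowest_at_uniq (F : fieldType) i j (v : {malg F[int]}) :
  lowest_at i v -> lowest_at j v -> i = j.
Proof.
move=> [vi lti] [vj ltj]; apply/eqP; case: ltgtP => // [/ltj|/lti] v0.
  by rewrite v0 eqxx in vi.
by rewrite v0 eqxx in vj.
Qed.

Lemma lowest_atZ (F : fieldType) i c (v : {malg F[int]}) :
  c != 0 -> lowest_at i v -> lowest_at i (c *: v).
Proof.
move=> c0 [vi lti]; split=> [|j /lti]; rewrite mcoeffZ ?mulf_neq0 // => ->.
by rewrite mulr0.
Qed.

Lemma lowest_atU (F : fieldType) i : lowest_at i (<< i >> : {malg F[int]}).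
Proof.
split=> [|j ij]; rewrite mcoeff_basis ?eqxx ?oner_eq0 //.
by rewrite gt_eqF.
Qed.

Lemma lowest_at_neq0 (F : fieldType) i (v : {malg F[int]}) : lowest_at i v -> v != 0.
Proof. by case=> vi _; apply: contra_neq vi => ->; rewrite mcoeff0. Qed.

Lemma seq_has_min (s : seq int) k : k \in s ->
  exists2 i, i \in s & forall j, j \in s -> i <= j.
Proof.
elim: s k => // a s IHs k _.
case: s IHs => [|b s] IHs.
  by exists a => [|j]; rewrite inE // => /eqP->.
have [i iv imin] := IHs b (mem_head _ _).
have [ai|/ltW ia] := leP a i; [exists a | exists i]; rewrite 1?inE ?eqxx ?iv ?orbT //.
  by move=> j; rewrite inE => /predU1P[->//|/imin]; apply: le_trans.
by move=> j; rewrite inE => /predU1P[->|/imin].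
Qed.

Lemma lowest_at_ex (F : fieldType) (v : {malg F[int]}) :
  v != 0 -> exists i, lowest_at i v.
Proof.
move=> /malg_neq0P[k vk].
have kv : k \in enum_fset (msupp v) by rewrite -[_ \in _]mcoeff_neq0.
have [i iv imin] := seq_has_min kv.
exists i; split; first by rewrite mcoeff_neq0.
move=> j ji; apply: mcoeff_outdom; apply/negP=> /imin; by rewrite leNgt ji.
Qed.

(** * Products along residue classes *)

Lemma bezout_int (m n : nat) : (0 < m)%N -> (0 < n)%N -> coprime m n ->
  forall z : int, exists a b : nat, z = a%:Z * n%:Z - b%:Z * m%:Z.
Proof.
move=> m0 n0 cmn [k|k].
  case: (egcdnP m n0) => a b E _; move: E; rewrite gcdnC (eqP cmn) => E.
  by exists (k * a)%N, (k * b)%N; nia.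
case: (egcdnP n m0) => a b E _; move: E; rewrite (eqP cmn) => E.
by exists (k.+1 * b)%N, (k.+1 * a)%N; nia.
Qed.

(** The relation [a n' - b m' = 1] makes [m'] and [n'] coprime: then [m / n] and
    [m' / n'] are two reduced forms of one fraction. *)
Lemma eq_of_coprime_ratio (m n m' n' a b : nat) :
    (0 < m)%N -> coprime m n -> (m * n' = n * m')%N ->
  (a * n' = b * m' + 1)%N -> m = m' /\ n = n'.
Proof.
move=> m0 cmn E ab.
have cmn' : coprime m' n'.
  have : (gcdn m' n' %| b * m' + 1)%N by rewrite -ab dvdn_mull ?dvdn_gcdr.
  by rewrite dvdn_addr ?dvdn_mull ?dvdn_gcdl // dvdn1.
have mE : m = m'.
  apply/eqP; rewrite eqn_dvd; apply/andP; split.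
    by rewrite -(Gauss_dvdr m' cmn) -E dvdn_mulr.
  by rewrite -(Gauss_dvdl m cmn') E dvdn_mull.
by split=> //; apply/eqP; rewrite -(eqn_pmul2l m0) E mE mulnC.
Qed.

Section Orbit.
Variables (F : fieldType) (q : F) (m n : nat) (f : int -> F).

(** The product of the weights met along [n] steps [i |-> i - m], which is
    one turn around the residues modulo [n] when [m] and [n] are coprime. *)
Definition orbprod (i : int) := \prod_(k < n) f (i - (k * m)%:Z).

Hypothesis f0 : forall i, f i != 0.

Lemma orbprod_neq0 i : orbprod i != 0.
Proof. by apply/prodf_neq0 => k _. Qed.

Hypothesis fq : forall i : int, f (i + n%:Z) = q * f i.

Lemma f_shift i (a : nat) : f (i + (a * n)%:Z) = q ^+ a * f i.
Proof.
elim: a => [|a IHa]; first by rewrite mul0n addr0 mul1r.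
rewrite exprS -mulrA -IHa -fq; congr f; lia.
Qed.

Lemma orbprod_Dn i : orbprod (i + n%:Z) = q ^+ n * orbprod i.
Proof.
rewrite /orbprod -[in q ^+ n](card_ord n) -prodr_const -big_split /=.
by apply: eq_bigr => k _; rewrite -fq addrAC.
Qed.

Hypothesis n0 : (0 < n)%N.

(** The product telescopes: shifting [i] by [m] trades the last factor
    [f (i - (n - 1) m)] for [f (i + m)], whose argument is higher by [m n],
    and that multiplies the value of [f] by [q^m]. *)
Lemma orbprod_Dm i : orbprod (i + m%:Z) = q ^+ m * orbprod i.
Proof.
rewrite /orbprod; case: n n0 f_shift => [//|n'] _ fS.
rewrite big_ord_recl [X in _ = _ * X]big_ord_recr /= mulrCA [LHS]mulrC.
have -> : q ^+ m * f (i - (n' * m)%:Z) = f (i + m%:Z - (0 * m)%:Z).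
  by rewrite -fS; congr f; lia.
congr (_ * _).
by apply: eq_bigr => k _; congr f; rewrite /bump /=; lia.
Qed.

Hypotheses (q0 : q != 0) (m0 : (0 < m)%N) (cmn : coprime m n).

Lemma orbprodD i (z : int) : orbprod (i + z) = q ^ z * orbprod i.
Proof.
have UP (a p : nat) : (forall i, orbprod (i + p%:Z) = q ^+ p * orbprod i) ->
    forall i, orbprod (i + a%:Z * p%:Z) = q ^+ (a * p) * orbprod i.
  move=> H; elim: a => [|a IHa] j; first by rewrite mul0r addr0 mul1r.
  have -> : j + a.+1%:Z * p%:Z = (j + a%:Z * p%:Z) + p%:Z by lia.
  by rewrite H IHa mulrA -exprD mulSn.
have [a [b zE]] := bezout_int m0 n0 cmn z.
have qb : q ^+ (b * m) != 0 by rewrite expf_neq0.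
(* Multiplying by [q^(b m)] turns [z] into [a n], leaving natural exponents. *)
apply: (mulfI qb); rewrite -UP; last exact: orbprod_Dm.
rewrite mulrA exprnP -expfzDr // zE.
have -> : i + (a%:Z * n%:Z - b%:Z * m%:Z) + b%:Z * m%:Z = i + a%:Z * n%:Z by ring.
rewrite UP; last exact: orbprod_Dn.
by rewrite exprnP; congr (_ ^ _ * _); lia.
Qed.

End Orbit.

(** Modulo [n], every [i] is [- j m] for a unique [j < n], namely the residue
    [J i] of [i b], where [b] is the inverse of [- m]. The equation then reads
    [c (- (j + 1) m) = h (- j m) c (- j m)] and is solved by partial products
    [G j]; as the full product is [1], these depend on [j] modulo [n]
    alone. *)
Lemma prod_periodic_cocycle (F : fieldType) (m n : nat) (h : int -> F) :
    (0 < m)%N -> (0 < n)%N -> coprime m n -> (forall i, h i != 0) ->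
    (forall i : int, h (i + n%:Z) = h i) ->
    \prod_(l < n) h (- (l * m)%:Z) = 1 ->
  exists c : int -> F, [/\ forall i, c i != 0,
    forall i, c (i + n%:Z) = c i & forall i, c (i - m%:Z) = h i * c i].
Proof.
move=> m0 n0 cmn h0 hn hprod.
have [a [b ab]] := bezout_int m0 n0 cmn 1.
have hnz (z i : int) : h (i + z * n%:Z) = h i.
  have hN (k : nat) l : h (l + k%:Z * n%:Z) = h l.
    elim: k => [|k IHk]; first by rewrite mul0r addr0.
    by rewrite -IHk -[in RHS]hn; congr h; lia.
  case: z => k; first exact: hN.
  by rewrite -(hN k.+1); congr h; rewrite NegzE; lia.
pose G j := \prod_(l < j) h (- (l * m)%:Z).
have GS j : G j.+1 = h (- (j * m)%:Z) * G j by rewrite /G big_ord_recr /= mulrC.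
have GDn j : G (j + n)%N = G j.
  elim: j => [|j IHj]; first by rewrite add0n /G hprod big_ord0.
  rewrite addSn !GS IHj -(hnz m%:Z); congr (h _ * _); lia.
have Gmod j : G (j %% n)%N = G j.
  rewrite [in RHS](divn_eq j n); elim: (j %/ n)%N => // d IHd.
  by rewrite mulSn -addnA addnC GDn.
pose J (i : int) := `|(i * b%:Z %% n%:Z)%Z|%N.
have JE i : (J i)%:Z = (i * b%:Z %% n%:Z)%Z.
  by rewrite /J gez0_abs // modz_ge0 // lt0n_neq0.
exists (G \o J); split=> i /=.
- by apply/prodf_neq0.
- by congr G; rewrite /J mulrDl [n%:Z * _]mulrC addrC modzMDl.
have -> : G (J (i - m%:Z)) = G (J i).+1.
  rewrite -Gmod -[RHS]Gmod; congr G; apply/eqP.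
  rewrite -eqz_nat -!modz_nat intS !JE modz_mod.
  rewrite modzDmr.
  have -> : (i - m%:Z) * b%:Z = 1 + i * b%:Z + (- a%:Z) * n%:Z by lia.
  by rewrite addrC modzMDl.
rewrite GS; congr (_ * _).
have := divz_eq (i * b%:Z) n%:Z; rewrite -JE PoszM.
move: (i * b%:Z %/ n%:Z)%Z (J i) => d j E.
rewrite -[LHS](hnz (i * a%:Z - d * m%:Z)); congr h.
have -> : - (j%:Z * m%:Z) + (i * a%:Z - d * m%:Z) * n%:Z
  = i * (a%:Z * n%:Z) - (d * n%:Z + j%:Z) * m%:Z by ring.
rewrite -E; have -> : a%:Z * n%:Z = 1 + b%:Z * m%:Z by lia.
ring.
Qed.

(** * The action on coefficients *)

Section Laurent.
Variables (F : fieldType) (q : F) (q1 : q != 1) (m n : nat) (f : int -> F).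
Hypothesis fq : forall i : int, f (i + n%:Z) = q * f i.
Local Notation V := (laurent_rep m q1 fq).
Local Notation L := {malg F[int]}.
Local Notation t := (laurent_t m q1 fq).

Lemma rep_scaleE (c : F) (v : V) : c%:A *: v = c *: (v : L) :> L.
Proof. exact: laurent_rep_scalar. Qed.

(** The combination of [1] and [X Y] in which the two terms of [Y] no longer
    mix: it sends [t^i] to [f(i) t^(i-m)]. *)
Definition qH : qWeyl q := 1 + (q - 1) *: (qX * qY).

Lemma mcoeff_X (v : V) j : (qX *: v : L)@_j = (v : L)@_(j - n%:Z).
Proof.
rewrite [qX *: v]qweyl_rep_X /= /laurentX.
rewrite (mcoeff_linextU (s := fun i => i + n%:Z)
  (s' := fun i => i - n%:Z) (c := fun=> 1)).
- by rewrite mul1r.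
- by move=> k; rewrite scale1r.
- by move=> k; rewrite addrK.
- by move=> k; rewrite subrK.
Qed.

Lemma mcoeff_Y (v : V) j : (qY *: v : L)@_j = (q - 1)^-1 *
  (f (j + n%:Z + m%:Z) * (v : L)@_(j + n%:Z + m%:Z) - (v : L)@_(j + n%:Z)).
Proof.
rewrite [qY *: v]qweyl_rep_Y /=.
have -> : laurentY q m n f v = (q - 1)^-1 *:
   (linext (fun i => f i *: << i - m%:Z - n%:Z >> : L) v
    - linext (fun i => << i - n%:Z >> : L) v).
  rewrite /laurentY /linext -sumrB scaler_sumr; apply: eq_bigr => k _.
  by rewrite scalerA mulrC -scalerA scalerBr.
rewrite mcoeffZ mcoeffB.
rewrite (mcoeff_linextU (s := fun i => i - m%:Z - n%:Z)
  (s' := fun i => i + n%:Z + m%:Z) (c := f)) //.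
rewrite (mcoeff_linextU (s := fun i => i - n%:Z)
  (s' := fun i => i + n%:Z) (c := fun=> 1)).
- by rewrite mul1r.
- by move=> k; rewrite scale1r.
- by move=> k; rewrite subrK.
- by move=> k; rewrite addrK.
- by move=> k; rewrite !subrK.
- by move=> k; rewrite !addrK.
Qed.

Lemma mcoeff_XY (v : V) j : ((qX * qY) *: v : L)@_j =
  (q - 1)^-1 * (f (j + m%:Z) * (v : L)@_(j + m%:Z) - (v : L)@_j).
Proof. by rewrite -scalerA mcoeff_X mcoeff_Y subrK. Qed.

Lemma mcoeff_H (v : V) j :
  (qH *: v : L)@_j = f (j + m%:Z) * (v : L)@_(j + m%:Z).
Proof.
rewrite scalerDl scale1r -mulr_algl -scalerA mcoeffD rep_scaleE mcoeffZ mcoeff_XY.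
by rewrite mulVKf ?subr_eq0 // addrC subrK.
Qed.

Lemma mcoeff_Xn a (v : V) j : (qX ^+ a *: v : L)@_j = (v : L)@_(j - a%:Z * n%:Z).
Proof.
elim: a j => [|a IHa] j; first by rewrite expr0 scale1r mul0r subr0.
rewrite exprS -scalerA mcoeff_X IHa; congr mcoeff; lia.
Qed.

Lemma mcoeff_Hn b (v : V) j : (qH ^+ b *: v : L)@_j =
  (\prod_(k < b) f (j + b%:Z * m%:Z - (k * m)%:Z)) * (v : L)@_(j + b%:Z * m%:Z).
Proof.
elim: b j => [|b IHb] j.
  by rewrite expr0 scale1r mul0r addr0 big_ord0 mul1r.
rewrite exprS -scalerA mcoeff_H IHb big_ord_recr /= mulrA; congr (_ * _).
  rewrite mulrC; congr (_ * _); last by congr f; lia.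
  by apply: eq_bigr => k _; congr f; lia.
congr mcoeff; lia.
Qed.

(** The exponents are chosen for the total shift [m n - n m] to vanish. *)
Definition qK : qWeyl q := qH ^+ n * qX ^+ m.

Lemma mcoeff_K (v : V) j :
  (qK *: v : L)@_j = orbprod m n f (j + (m * n)%:Z) * (v : L)@_j.
Proof.
rewrite -scalerA mcoeff_Hn mcoeff_Xn.
have -> : j + n%:Z * m%:Z = j + (m * n)%:Z by rewrite mulnC.
by congr (_ * mcoeff _ _); lia.
Qed.

Lemma K_t i :
  qK *: t i
  = (orbprod m n f (i + (m * n)%:Z))%:A *: t i.
Proof.
apply/(@malgP int F) => j; rewrite mcoeff_K rep_scaleE mcoeffZ !mcoeff_basis.
by case: eqVneq => [->|]; rewrite ?mulr0.
Qed.

Hypothesis f0 : forall i, f i != 0.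

Lemma lowest_at_X a i (v : V) :
  lowest_at i (v : L) -> lowest_at (i + a%:Z * n%:Z) (qX ^+ a *: v : L).
Proof.
move=> [vi lti]; split=> [|j ij]; rewrite mcoeff_Xn ?addrK //.
by apply: lti; rewrite ltrBlDr.
Qed.

Lemma lowest_at_H b i (v : V) :
  lowest_at i (v : L) -> lowest_at (i - b%:Z * m%:Z) (qH ^+ b *: v : L).
Proof.
move=> [vi lti]; split=> [|j ij]; rewrite mcoeff_Hn ?subrK ?mulf_neq0 //.
  by apply/prodf_neq0.
by rewrite lti ?mulr0 // -ltrBrDr.
Qed.

Lemma lowest_at_HX b a i (v : V) : lowest_at i (v : L) ->
  lowest_at (i + (a%:Z * n%:Z - b%:Z * m%:Z)) ((qH ^+ b * qX ^+ a) *: v : L).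
Proof. by move=> /(lowest_at_X a)/(lowest_at_H b); rewrite -scalerA addrA. Qed.

Lemma HX_t b a i : exists2 c : F, c != 0 &
  (qH ^+ b * qX ^+ a) *: t i
  = c%:A *: t (i + (a%:Z * n%:Z - b%:Z * m%:Z)).
Proof.
exists (\prod_(k < b) f (i + a%:Z * n%:Z - (k * m)%:Z)); first by apply/prodf_neq0.
apply/(@malgP int F) => j.
rewrite rep_scaleE mcoeffZ -scalerA mcoeff_Hn mcoeff_Xn !mcoeff_basis.
case: eqVneq => [ij|].
  have -> : j + b%:Z * m%:Z = i + a%:Z * n%:Z by rewrite ij subrK.
  by congr (_ * (_ : bool)%:R); apply/esym/eqP; lia.
by move=> ij; rewrite (_ : _ == _ = false) ?mulr0 //; apply/eqP => E; case/eqP: ij; lia.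
Qed.

(** * Absence of irreducible submodules over the subalgebra generated by XY *)

Hypothesis m0 : (0 < m)%N.

(** The coefficient at [i - m] in [X Y v] involves those of [v] at [i] and at
    [i - m] only, and the latter vanishes since [m] is positive. *)
Lemma lowest_at_XY i (v : V) :
  lowest_at i (v : L) -> lowest_at (i - m%:Z) ((qX * qY) *: v : L).
Proof.
move=> [vi lti]; split=> [|j ij]; rewrite mcoeff_XY ?subrK.
  rewrite (lti (i - _)) ?subr0 ?mulf_neq0 ?invr_eq0 ?subr_eq0 //.
  by lia.
by rewrite !lti ?mulr0 ?subrr ?mulr0 //; lia.
Qed.

(** By Horner's scheme: in [p(XY) XY v + c v] the first summand, if [p] is
    nonzero, starts strictly below [v], so nothing cancels its lowest term. *)
Lemma lowest_at_poly_XY p i (v : V) : p != 0 -> lowest_at i (v : L) ->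
  exists2 j, j <= i & lowest_at j (horner_alg (qX * qY) p *: v : L).
Proof.
elim/poly_ind: p i v => [|p c IHp] i v; first by rewrite eqxx.
rewrite rmorphD rmorphM /= horner_algX horner_algC scalerDl -scalerA => pc vi.
have [p0|p0] := eqVneq p 0.
  exists i => //; rewrite p0 rmorph0 scale0r add0r rep_scaleE.
  by apply: lowest_atZ => //; apply: contraNneq pc => ->; rewrite p0 mul0r add0r.
have [j jle [wj ltj]] := IHp _ _ p0 (lowest_at_XY vi).
have ji : j < i by lia.
have [_ lti] := vi.
exists j; first exact: ltW.
split=> [|l lj]; rewrite mcoeffD rep_scaleE mcoeffZ lti ?mulr0 ?addr0 //.
  exact: ltj.
exact: lt_trans lj ji.
Qed.

(** If [W] were irreducible and contained [v != 0], its nonzero submodule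
    generated by [X Y v] would contain [v], that is [v = XY p(XY) v], and
    the nonzero polynomial [1 - x p(x)] would kill [v]. *)
Lemma no_irreducible_over_XY (W : V -> Prop) :
  ~ irreducible_submodule (generated_subalgebra (qX * qY)) W.
Proof.
move=> [[W0 WB WZ] [v Wv v0] Wirr].
have [i vi] := lowest_at_ex v0.
pose U (w : V) := exists p, w = horner_alg (qX * qY) ('X * p) *: v.
have Usub : is_submodule (generated_subalgebra (qX * qY)) U.
  split; first by exists 0; rewrite mulr0 rmorph0 scale0r.
  - move=> _ _ [p ->] [r ->]; exists (p - r).
    by rewrite mulrBr rmorphB scalerBl.
  - move=> _ _ [p ->] [r ->]; exists (p * r).
    by rewrite scalerA -rmorphM /= mulrCA.
have UW w : U w -> W w by move=> [p ->]; apply: WZ => //; exists ('X * p).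
have [U0|WU] := Wirr U Usub UW.
  have /U0 : U ((qX * qY) *: v) by exists 1; rewrite mulr1 horner_algX.
  by apply/eqP; apply: lowest_at_neq0 (lowest_at_XY vi).
have [p pE] := WU v Wv.
have r0 : 1 - 'X * p != 0.
  apply/eqP => /(congr1 (horner^~ 0)); rewrite /= hornerD hornerN hornerM hornerX.
  by rewrite mul0r subr0 hornerC horner0 => /eqP; rewrite oner_eq0.
have [j _ /lowest_at_neq0] := lowest_at_poly_XY r0 vi.
by rewrite rmorphB rmorph1 scalerBl scale1r -pE subrr eqxx.
Qed.

Lemma not_semisimple_over_XY :
  ~ semisimple_over V (generated_subalgebra (qX * qY)).
Proof.
move=> /(_ (t 0))[[|w s] tE irr].
  by have := lowest_at_neq0 (lowest_atU F 0); rewrite [<< _ >>]tE big_nil eqxx.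
have [W /no_irreducible_over_XY//] := irr w (mem_head _ _).
Qed.

(** * Irreducibility *)

Hypotheses (q0 : q != 0) (qroot : not_root_of_unity q)
  (n0 : (0 < n)%N) (cmn : coprime m n).

Lemma qpow_inj : injective (fun z : int => q ^ z).
Proof.
have qz1 (z : int) : q ^ z = 1 -> z = 0.
  have qk1 (k : nat) : q ^+ k = 1 -> k = 0%N.
    case: k => // k qk; have := qroot (ltn0Sn k).
    by rewrite unity_rootE qk eqxx.
  case: z => k; first by rewrite -exprnP => /qk1->.
  by rewrite NegzE -exprnN => /(congr1 GRing.inv); rewrite invrK invr1 => /qk1.
move=> y z /= yz; apply/eqP; rewrite -subr_eq0; apply/eqP/qz1.
by rewrite expfzDr // yz -expfzDr // subrr.
Qed.

Lemma K_eig_inj : injective (fun j => orbprod m n f (j + (m * n)%:Z)).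
Proof.
move=> i j.
rewrite -[i + _]add0r -[j + _]add0r !(orbprodD fq n0 q0 m0 cmn).
by move=> /(mulIf (orbprod_neq0 m n f0 0))/qpow_inj/addIr.
Qed.

Lemma submodule_t (U : V -> Prop) v k : is_submodule (fun=> True) U ->
  U v -> (v : L)@_k != 0 -> U (t k).
Proof.
move=> [U0 UB UZ].
apply: (diag_stable_mem (D := fun v : V => qK *: v)
  (lam := fun j => orbprod m n f (j + (m * n)%:Z)) (U := U)).
- exact: mcoeff_K.
- exact: K_eig_inj.
- exact: UB.
- by move=> c w Uw; rewrite -(rep_scaleE c w); apply: UZ.
- by move=> w Uw; apply: UZ.
Qed.

Lemma laurent_irreducible : irreducible_module V.
Proof.
split=> //.
  exists (t 0) => //; exact: (lowest_at_neq0 (lowest_atU F 0)).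
move=> U Usub _; have [U0 UB UZ] := Usub.
have [|v0] := pselect (exists2 v, U v & v != 0); last first.
  by left=> v Uv; apply/eqP/negPn/negP => vN; apply: v0; exists v.
move=> [v Uv /malg_neq0P[k vk]]; right.
have Ut i : U (t i).
  have [a [b ab]] := bezout_int m0 n0 cmn (i - k).
  have := UZ (qH ^+ b * qX ^+ a) _ I (submodule_t Usub Uv vk).
  have [c c0 ->] := HX_t b a k; rewrite -ab addrC subrK.
  move/(UZ c^-1%:A _ I); rewrite scalerA.
  by rewrite -scalerAl mul1r scalerA mulVf // scale1r scale1r.
move=> w _; change (U (w : L)); rewrite (monalgE (w : L)).
have UD x y : U x -> U y -> U (x + y).
  by move=> Ux Uy; have := UB _ _ Ux (UB _ _ U0 Uy); rewrite sub0r opprK.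
elim/big_ind: _ => // l _.
suff -> : << (w : L)@_l *g l >> = ((w : L)@_l)%:A *: t l :> L.
  by apply: UZ.
rewrite rep_scaleE; apply/malgP => j.
by rewrite mcoeffZ mcoeff_basis mcoeffU mulr_natr.
Qed.

(** The line spanned by [v] is stable under [K], so it contains every
    monomial that occurs in [v]. *)
Lemma K_eigenvector (v : V) c : v != 0 -> qK *: v = c%:A *: v ->
  exists i, exists2 d : F, d != 0 & t i = d%:A *: v.
Proof.
move=> v0 Kv; have /malg_neq0P[i vi] : (v : L) != 0 by [].
exists i; pose U (w : L) := exists d : F, w = d *: (v : L).
have [d dE] : U << i >>.
  apply: (diag_stable_mem (D := fun v : V => qK *: v)
    (lam := fun j => orbprod m n f (j + (m * n)%:Z)) _ _ _ _ _ _ vi).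
  - exact: mcoeff_K.
  - exact: K_eig_inj.
  - by move=> _ _ [a ->] [b ->]; exists (a - b); rewrite scalerBl.
  - by move=> a _ [b ->]; exists (a * b); rewrite scalerA.
  - move=> w [b ->]; exists (b * c).
    have bK : qK * b%:A = b%:A * qK by rewrite mulr_algl mulr_algr.
    rewrite -(rep_scaleE b v) scalerA bK -[_ *: v]scalerA Kv.
    by rewrite !rep_scaleE scalerA.
  - by exists 1; rewrite scale1r.
exists d; last by rewrite -[LHS]/(<< i >> : L) dE rep_scaleE.
apply: contra_eq_neq dE => ->; rewrite scale0r.
exact: (lowest_at_neq0 (lowest_atU F i)).
Qed.

End Laurent.

(** * Isomorphisms *)

Lemma free_act_intertwine (F : fieldType) (V W : lmodType F)
    (x y : {linear V -> V}) (x' y' : {linear W -> W}) (phi : {linear V -> W}) :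
    (forall v, phi (x v) = x' (phi v)) -> (forall v, phi (y v) = y' (phi v)) ->
  forall p v, phi (free_act x y p v) = free_act x' y' p (phi v).
Proof.
move=> phix phiy p v; rewrite /free_act /linext linear_sum.
apply: eq_bigr => w _; rewrite linearZ; congr (_ *: _); rewrite /word_act.
by elim: (w : seq _) => //= i s <-; rewrite /letter_act; case: ifP.
Qed.

Section Isomorphisms.
Variables (F : fieldType) (q : F) (q1 : q != 1).
Local Notation L := {malg F[int]}.

(** Since [qX] and [qY] generate the algebra, commuting with both is enough
    for a linear map to be a morphism of representations. *)
Lemma laurent_intertwiner_linear (m n m' n' : nat) (f f' : int -> F)
    (fq : forall i : int, f (i + n%:Z) = q * f i)
    (fq' : forall i : int, f' (i + n'%:Z) = q * f' i)
    (phi : {linear L -> L}) :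
    (forall v : laurent_rep m q1 fq,
       phi (qX *: v) = qX *: (phi v : laurent_rep m' q1 fq') :> L) ->
    (forall v : laurent_rep m q1 fq,
       phi (qY *: v) = qY *: (phi v : laurent_rep m' q1 fq') :> L) ->
  forall (a : qWeyl q) (v : laurent_rep m q1 fq),
    phi (a *: v) = a *: (phi v : laurent_rep m' q1 fq') :> L.
Proof.
move=> phiX phiY a v; apply: free_act_intertwine => {}v.
  by have := phiX v; rewrite !qweyl_rep_X.
by have := phiY v; rewrite !qweyl_rep_Y.
Qed.

(** * Construction of isomorphisms *)

Section SameShifts.
Variables (m n : nat) (f f' : int -> F).
Hypotheses (fq : forall i : int, f (i + n%:Z) = q * f i)
  (fq' : forall i : int, f' (i + n%:Z) = q * f' i).
Local Notation V := (laurent_rep m q1 fq).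
Local Notation V' := (laurent_rep m q1 fq').

(** The isomorphism is [t^i |-> c(i) t^(i-k)]: periodicity of [c] makes it
    commute with [X], and the twisting relation with [Y]. *)
Lemma isomorphic_of_twist (k : int) (c : int -> F) :
    (forall i, c i != 0) -> (forall i, c (i + n%:Z) = c i) ->
    (forall i, f i * c (i - m%:Z) = f' (i - k) * c i) ->
  isomorphic V V'.
Proof.
move=> c0 cn ctwist.
pose phi : {linear L -> L} := linext (fun i => c i *: << i - k >>).
pose psi : {linear L -> L} := linext (fun i => (c (i + k))^-1 *: << i + k >>).
have phiE v j : (phi v)@_j = c (j + k) * v@_(j + k).
  rewrite /phi /= (mcoeff_linextU (s := fun i => i - k) (s' := fun i => i + k) (c := c)) //.
  - exact: subrK.
  - exact: addrK.
have psiE v j : (psi v)@_j = (c j)^-1 * v@_(j - k).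
  rewrite /psi /= (mcoeff_linextU (s := fun i => i + k) (s' := fun i => i - k)
    (c := fun i => (c (i + k))^-1)) ?subrK //.
  - exact: addrK.
  - exact: subrK.
have phi_lin : linear (phi : V -> V').
  move=> a u v; rewrite linearD; congr (_ + _).
  apply: laurent_intertwiner_linear => {a u} {}v; apply/malgP => j.
    rewrite phiE !mcoeff_X phiE -[in RHS]cn.
    by congr (_ * _); [congr c | congr mcoeff]; lia.
  rewrite phiE !mcoeff_Y !phiE mulrCA; congr (_ * _); rewrite mulrBr.
  congr (_ - _); last first.
    by rewrite -[in LHS]cn; congr (_ * _); [congr c | congr mcoeff]; lia.
  rewrite !mulrA; congr (_ * _); last by congr mcoeff; lia.
  have := ctwist (j + n%:Z + m%:Z + k); rewrite addrK => <-.
  by rewrite mulrC -[c (j + k)]cn; congr (_ * _); [congr f | congr c]; lia.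
pose Phi : {linear V -> V'} :=
  HB.pack (phi : V -> V') (GRing.isLinear.Build _ V V' _ (phi : V -> V') phi_lin).
exists Phi; exists (psi : V' -> V) => v; apply/malgP => j.
  by rewrite psiE phiE subrK mulKf.
by rewrite phiE psiE addrK mulVKf.
Qed.

Hypotheses (m0 : (0 < m)%N) (n0 : (0 < n)%N) (cmn : coprime m n)
  (q0 : q != 0) (f0 : forall i, f i != 0) (f0' : forall i, f' i != 0).

(** The required quotients [h i = f' (i - k) / f i] are periodic because [f]
    and [f'] scale by the same [q], and their product over a turn is
    [s_f'(- k) / s_f(0) = q^(-k) s_f'(0) / s_f(0) = 1]. *)
Lemma isomorphic_of_orbprod (k : int) :
  orbprod m n f' 0 = q ^ k * orbprod m n f 0 -> isomorphic V V'.
Proof.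
move=> Ek; pose h i := f' (i - k) / f i.
have [i|i||c [c0 cn cm]] := @prod_periodic_cocycle _ m n h m0 n0 cmn.
- by rewrite mulf_neq0 ?invr_eq0.
- by rewrite /h addrAC fq fq' -mulf_div divff // mul1r.
- rewrite /h big_split /= prodfV.
  rewrite (_ : \prod_(i < n) f _ = orbprod m n f 0); last first.
    by apply: eq_bigr => l _; rewrite sub0r.
  rewrite (_ : \prod_(i < n) f' _ = orbprod m n f' (0 - k)); last first.
    by apply: eq_bigr => l _; congr f'; lia.
  rewrite (orbprodD fq' n0 q0 m0 cmn) Ek mulrA -expfzDr // addNr expr0z mul1r.
  by rewrite divff // orbprod_neq0.
apply: (isomorphic_of_twist (k := k) c0 cn) => i.
by rewrite cm mulrA; congr (_ * _); rewrite /h mulrC divfK.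
Qed.

End SameShifts.

(** * Invariants of the isomorphism class *)

Section Necessity.
Variables (m n m' n' : nat) (f f' : int -> F).
Hypotheses (fq : forall i : int, f (i + n%:Z) = q * f i)
  (fq' : forall i : int, f' (i + n'%:Z) = q * f' i).
Local Notation V := (laurent_rep m q1 fq).
Local Notation V' := (laurent_rep m' q1 fq').
Hypotheses (m0 : (0 < m)%N) (n0 : (0 < n)%N) (cmn : coprime m n)
  (q0 : q != 0) (qroot : not_root_of_unity q)
  (f0 : forall i, f i != 0) (f0' : forall i, f' i != 0).
Variable phi : {linear V -> V'}.
Hypothesis phi_bij : bijective phi.

Local Notation t := (laurent_t m q1 fq).
Local Notation t' := (laurent_t m' q1 fq').

Lemma phi_neq0 v : v != 0 -> phi v != 0.
Proof.
apply: contra_neq => pv0; apply: (bij_inj phi_bij).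
by rewrite pv0 linear0.
Qed.

(** The image of [t^0] is an eigenvector of [K], hence keeps its lowest
    exponent under [K]; but in the target [K] shifts lowest exponents by
    [m n' - n m']. *)
Lemma iso_same_slope : (m * n' = n * m')%N.
Proof.
have [i wi] := lowest_at_ex (phi_neq0 (lowest_at_neq0 (lowest_atU F 0) : t 0 != 0)).
have := lowest_at_HX f0' n m wi.
have := congr1 phi (K_t q1 m fq 0); rewrite !linearZ /= => ->.
rewrite rep_scaleE => /lowest_at_uniq/(_ (lowest_atZ (orbprod_neq0 m n f0 _) wi)).
lia.
Qed.

(** With [m n' = n m'], the element [K] is diagonal in the target as well, so
    the preimage of [t'^i] is an eigenvector of [K]. *)
Lemma iso_preimage_t i : exists k, exists2 d : F, d != 0 & phi (t k) = d%:A *: t' i.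
Proof.
have [psi phiK psiK] := phi_bij.
have v0 : psi (t' i) != 0.
  apply/eqP=> E; have := lowest_at_neq0 (lowest_atU F i).
  by rewrite -[<< i >>](psiK (t' i)) E; rewrite linear0 eqxx.
have [c _ cE] := HX_t q1 m' fq' f0' n m i.
have Kv : qK q m n *: psi (t' i) = c%:A *: psi (t' i).
  apply: (can_inj phiK); rewrite !linearZ /= psiK cE.
  by have := iso_same_slope => E; congr (_ *: laurent_t _ _ _ _); lia.
have [k [d d0 E]] := K_eigenvector f0 m0 q0 qroot n0 cmn v0 Kv.
exists k; exists d; first exact: d0.
rewrite E linearZ /= psiK.
reflexivity.
Qed.

(** Since [H^b X^a] links the preimages of [t'^0] and [t'^1] for some [a] and
    [b], the same element links [t'^0] to [t'^1] in the target, which forces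
    [a n' - b m' = 1]. *)
Lemma iso_shifts : m = m' /\ n = n'.
Proof.
have [k0 [d0 nz0 E0]] := iso_preimage_t 0.
have [k1 [d1 nz1 E1]] := iso_preimage_t 1.
have [a [b ab]] := bezout_int m0 n0 cmn (k1 - k0).
have [c c0] := HX_t q1 m fq f0 b a k0; rewrite -ab addrC subrK.
move=> /(congr1 phi); rewrite !linearZ /= E0 E1 => HE.
have o0 : lowest_at 0 (d0%:A *: t' 0 : L).
  by rewrite rep_scaleE; apply: lowest_atZ nz0 (lowest_atU F 0).
have o1 : lowest_at 1 (c%:A *: (d1%:A *: t' 1) : L).
  rewrite !rep_scaleE; apply: lowest_atZ c0 _.
  exact: lowest_atZ nz1 (lowest_atU F 1).
have := lowest_at_HX f0' b a o0; rewrite HE => /lowest_at_uniq/(_ o1) ab1.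
apply: (eq_of_coprime_ratio m0 cmn iso_same_slope (a := a) (b := b)).
clear -ab1; lia.
Qed.

End Necessity.

(** Up to a unit, some [t^k] is sent to [t'^0]; both have the same eigenvalue
    under [K]. *)
Lemma iso_orbprod (m n : nat) (f f' : int -> F)
    (fq : forall i : int, f (i + n%:Z) = q * f i)
    (fq' : forall i : int, f' (i + n%:Z) = q * f' i)
    (phi : {linear laurent_rep m q1 fq -> laurent_rep m q1 fq'}) :
    (0 < m)%N -> (0 < n)%N -> coprime m n -> q != 0 -> not_root_of_unity q ->
    (forall i, f i != 0) -> (forall i, f' i != 0) -> bijective phi ->
  exists k : int, orbprod m n f' 0 = q ^ k * orbprod m n f 0.
Proof.
move=> m0 n0 cmn q0 qroot f0 f0' phi_bij.
have [k [d d0 E]] := iso_preimage_t m0 n0 cmn q0 qroot f0 f0' phi_bij 0.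
exists k; have := congr1 phi (K_t q1 m fq k).
(* The two eigenvalues are compared on the coefficient of [t'^0]. *)
rewrite !linearZ /= E => /(congr1 (mcoeff (0 : int))).
rewrite mcoeff_K !rep_scaleE !mcoeffZ mcoeff_basis eqxx mulr1.
move/(mulIf d0); rewrite add0r -[X in orbprod _ _ f' X]add0r -[X in orbprod _ _ f X]add0r.
rewrite !(orbprodD _ n0 q0 m0 cmn) // expfzDr // [q ^ k * _]mulrC -mulrA.
by apply: mulfI; rewrite expfz_neq0.
Qed.

End Isomorphisms.

Theorem proposition3p1 (F : fieldType) (q : F) (hq0 : q != 0)
    (hq : not_root_of_unity q)
    (m n : nat) (hm : (0 < m)%N) (hn : (0 < n)%N) (hmn : gcdn m n = 1%N)
    (f : int -> F) (hf0 : forall i, f i != 0)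
    (hf : forall i : int, f (i + n%:Z) = q * f i) :
  let q1 := not_root_of_unity_neq1 hq in
  let V := laurent_rep m q1 hf in
  [/\ irreducible_module V,
      forall (m' n' : nat) (hm' : (0 < m')%N) (hn' : (0 < n')%N)
        (f' : int -> F) (hf0' : forall i, f' i != 0)
        (hf' : forall i : int, f' (i + n'%:Z) = q * f' i),
        isomorphic V (laurent_rep m' q1 hf') <->
        [/\ m = m', n = n' &
            exists k : int,
              \prod_(i < n') f' (- (i * m')%:Z) =
              q ^ k * \prod_(i < n) f (- (i * m)%:Z)]
    & ~ semisimple_over V (generated_subalgebra (qX * qY))
      /\ ~ weight_representation V].
Proof.
move=> q1 V; have cmn : coprime m n by apply/eqP.
have orb0 (g : int -> F) : \prod_(i < n) g (- (i * m)%:Z) = orbprod m n g 0.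
  by apply: eq_bigr => i _; rewrite sub0r.
split; first exact: laurent_irreducible.
  move=> m' n' hm' hn' f' hf0' hf'; split=> [[phi phi_bij]|[mE nE]].
    have [mE nE] := iso_shifts hm hn cmn hq0 hq hf0 hf0' phi_bij.
    split=> //; subst m' n'; rewrite !orb0; exact: iso_orbprod phi_bij.
  subst m' n'; rewrite !orb0 => -[k]; exact: isomorphic_of_orbprod.
by split; apply: not_semisimple_over_XY.
Qed.
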